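(* (Single sample.) Let $n,m,l\ge 1$, $F\in\mathcal{L}_{2^n\times 2^{m+n}}$, $H\in\mathcal{L}_{2^l\times 2^n}$, and consider the Boolean control network $$x(t+1)=F\,(u(t)\otimes x(t)),\qquad y(t)=Hx(t),\qquad t\in\mathbb{N},$$ with $x(t)\in\Delta_{2^n}$, $u(t)\in\Delta_{2^m}$, $y(t)\in\Delta_{2^l}$. If this Boolean control network is controllable and O1-observable, then it is uniquely identifiable from sufficient single-sample data. That is: for every initial state $x_0\in\Delta_{2^n}$ of the sample, if $F'\in\mathcal{L}_{2^n\times 2^{m+n}}$ and $H'\in\mathcal{L}_{2^l\times 2^n}$ are such that the Boolean control network $(F',H')$ generates the available data recorded from $(F,H)$ with initial state $x_0$, then there is a $2^n\times 2^n$ permutation matrix $G$ with $F'=GF(I_{2^m}\otimes G^{\mathrm T})$ and $H'=HG^{\mathrm T}$.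
   Context: Notation: $\mathbb{N}=\{0,1,2,\dots\}$; $\delta_k^i$ is the $i$-th column of the identity matrix $I_k$; $\Delta_k=\{\delta_k^1,\dots,\delta_k^k\}$; $\mathcal{L}_{p\times q}$ is the set of real $p\times q$ matrices all of whose columns lie in $\Delta_p$; $\otimes$ is the Kronecker product. Controllability: for any initial state $x(0)=x_0\in\Delta_{2^n}$ and any $x_d\in\Delta_{2^n}$ there exist $T\in\mathbb{N}$ and an input sequence $(u(0),\dots,u(T))$ in $\Delta_{2^m}$ such that $x(T+1)=x_d$. O1-observability: for any two distinct states $x(0)\neq\bar x(0)$ in $\Delta_{2^n}$ there exists an input sequence $(u(0),u(1),\dots)$ in $\Delta_{2^m}$ such that the corresponding output sequences (generated from $x(0)$ and $\bar x(0)$ under this same input) are distinct: $(y(0),y(1),\dots)\neq(\bar y(0),\bar y(1),\dots)$. Available data (single sample, sufficient data): one sample, i.e. one fixed unknown initial state $x_0$, is divided into portions, and to each portion an input sequence is applied and the resulting output sequence is recorded; the data are assumed sufficient, i.e. they contain everything the system can generate from $x_0$. So the available data are the pairs consisting of an arbitrary input sequence $(u(0),\dots,u(p))$, $p\in\mathbb{N}$, and the output sequence $(y(0),\dots,y(p+1))$ it produces from $x(0)=x_0$. A Boolean control network $(F',H')$ generates these data if there is a single state $x_0'\in\Delta_{2^n}$ such that, for every $p$ and every input sequence $(u(0),\dots,u(p))$, the network $(F',H')$ started at $x_0'$ produces the same output sequence as $(F,H)$ started at $x_0$. Unique identifiability: $F,H$ are determined by the available data up to a coordinate change $\omega=Gx$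 of the state ($G$ a permutation matrix), under which $(F,H)$ becomes $(GF(I_{2^m}\otimes G^{\mathrm T}),HG^{\mathrm T})$. The dimensions $n,m,l$ are known. *)

(* Defs.v *)
From mathcomp Require Import all_boot all_order all_algebra reals.
From mathcomp.real_closed Require Import mxtens.

Set Implicit Arguments.
Unset Strict Implicit.
Unset Printing Implicit Defensive.

Import GRing.Theory.
Local Open Scope ring_scope.

Definition Delta {R : realType} (k : nat) : {pred 'cV[R]_k} :=
  [pred x | [exists i : 'I_k, x == col i 1%:M]].
Arguments Delta {R} k _ : simpl never.

Definition logical_mx {R : realType} (p q : nat) : {pred 'M[R]_(p, q)} :=
  [pred A | [forall j : 'I_q, col j A \in Delta p]].
Arguments logical_mx {R} p q _ : simpl never.

(* The width 2^(m+n) of F is written 2^m * 2^n, the height of the Kronecker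
   product u *t x, so that F *m (u *t x) needs no cast.  The width 1 * 1 of
   u *t x is convertible to 1. *)
Section BooleanControlNetwork.
Context {R : realType} {n m l : nat}.
Implicit Types (F : 'M[R]_(2 ^ n, 2 ^ m * 2 ^ n)) (H : 'M[R]_(2 ^ l, 2 ^ n)).
Implicit Types (x : 'cV[R]_(2 ^ n)) (u : nat -> 'cV[R]_(2 ^ m)).

Fixpoint state F x u (t : nat) : 'cV[R]_(2 ^ n) :=
  if t is s.+1 then F *m (u s *t state F x u s) else x.

Definition output F H x u (t : nat) : 'cV[R]_(2 ^ l) := H *m state F x u t.

(* A finite input sequence (u 0, ..., u p) is a function on nat of which only
   the values at t <= p are constrained: the states and outputs up to time p+1
   depend on no other value. *)
Definition input_upto (p : nat) u : Prop :=
  forall t : nat, (t <= p)%N -> u t \in Delta (2 ^ m).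

Definition controllable F : Prop :=
  forall x0 xd, x0 \in Delta (2 ^ n) -> xd \in Delta (2 ^ n) ->
  exists (T : nat) u, input_upto T u /\ state F x0 u T.+1 = xd.

Definition O1_observable F H : Prop :=
  forall x xbar, x \in Delta (2 ^ n) -> xbar \in Delta (2 ^ n) -> x <> xbar ->
  exists2 u, (forall t : nat, u t \in Delta (2 ^ m)) &
    exists t : nat, output F H x u t <> output F H xbar u t.

(* The data are sufficient: they record the response of (F, H) from the one
   initial state x0 to every finite input sequence. *)
Definition generates_data F H x0 F' H' : Prop :=
  exists2 x0', x0' \in Delta (2 ^ n) &
    forall (p : nat) u, input_upto p u ->
    forall t : nat, (t <= p.+1)%N ->
      output F' H' x0' u t = output F H x0 u t.

Definition uniquely_identifiable F H : Prop :=
  forall x0, x0 \in Delta (2 ^ n) ->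
  forall F' H',
    F' \in logical_mx (2 ^ n) (2 ^ m * 2 ^ n) ->
    H' \in logical_mx (2 ^ l) (2 ^ n) ->
    generates_data F H x0 F' H' ->
  exists G : 'M[R]_(2 ^ n),
    [/\ is_perm_mx G, F' = G *m F *m (1%:M *t G^T) & H' = H *m G^T].

End BooleanControlNetwork.

(* Main.v *)
Require Import Defs.
From mathcomp Require Import all_boot all_order all_algebra reals.
From mathcomp Require Import fingroup perm.
From mathcomp.real_closed Require Import mxtens.
Import GRing.Theory.
Local Open Scope ring_scope.

(** Call a state [x'] of [(F', H')] equivalent to a state [x] of [(F, H)] if every
    input sequence produces the same outputs from both; equivalence is preserved
    by applying one more input.  The data make [x0'] equivalent to [x0], and
    controllability drives [x0] to every state, so every state [x] of [(F, H)]
    has some equivalent [s x].  O1-observability makes [s] injective, hence, both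
    state sets having [2 ^ n] elements, a permutation.  If [y] is the successor
    of [x] under [u], the successor of [s x] under [u] is some [s z] by
    surjectivity; as it is also equivalent to [y], observability gives [z = y].
    So [s] conjugates the two networks. *)

Section LogicalVectors.
Set Implicit Arguments.
Unset Strict Implicit.
Unset Printing Implicit Defensive.
Context {R : realType}.

Lemma DeltaP (k : nat) (x : 'cV[R]_k) :
  reflect (exists i, x = col i 1%:M) (x \in Delta k).
Proof. exact: 'exists_eqP. Qed.

Lemma col1_Delta (k : nat) (i : 'I_k) : col i 1%:M \in Delta (R := R) k.
Proof. by apply/DeltaP; exists i. Qed.

Lemma col1_inj (k : nat) : injective (fun i : 'I_k => col i (1%:M : 'M[R]_k)).
Proof.
move=> i j /colP/(_ i); rewrite !mxE eqxx.
by case: eqP => // _ /eqP; rewrite oner_eq0.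
Qed.

Lemma mulmx_col1 (p q : nat) (A : 'M[R]_(p, q)) (j : 'I_q) :
  A *m col j 1%:M = col j A.
Proof. by rewrite !colE mul1mx. Qed.

Lemma logical_mulmx (p q : nat) (A : 'M[R]_(p, q)) (x : 'cV[R]_q) :
  A \in logical_mx p q -> x \in Delta q -> A *m x \in Delta p.
Proof. by move=> /forallP hA /DeltaP[j ->]; rewrite mulmx_col1. Qed.

(** Entrywise, a product of two indicators is the indicator of the conjunction, and pairing of
    indices is injective. *)
Lemma tens_col1 (p q : nat) (i : 'I_p) (j : 'I_q) :
  col i 1%:M *t col j 1%:M = col (mxtens_index (i, j)) 1%:M :> 'cV[R]_(p * q).
Proof.
apply/matrixP=> k l; case: (mxtens_indexP k) => a b.
rewrite !mxE mxtens_indexK /= -natrM mulnb.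
by rewrite (inj_eq (can_inj (@mxtens_indexK p q))).
Qed.

Lemma tens_Delta (p q : nat) (x : 'cV[R]_p) (y : 'cV[R]_q) :
  x \in Delta p -> y \in Delta q -> x *t y \in Delta (p * q).
Proof. by move=> /DeltaP[i ->] /DeltaP[j ->]; rewrite tens_col1 col1_Delta. Qed.

Lemma eq_mulmx_col1 (p q : nat) (A B : 'M[R]_(p, q)) :
  (forall j, A *m col j 1%:M = B *m col j 1%:M) -> A = B.
Proof.
move=> eqAB; apply/matrixP=> i j.
by have := eqAB j; rewrite !mulmx_col1 => /colP/(_ i); rewrite !mxE.
Qed.

(** Row [i] of [perm_mx s] has its 1 in column [s i], so this matrix acts on basis vectors by the
    inverse of [s]. *)
Lemma perm_mx_col1 (k : nat) (s : 'S_k) (j : 'I_k) :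
  perm_mx s *m col (s j) 1%:M = col j 1%:M :> 'cV[R]_k.
Proof.
by rewrite mulmx_col1; apply/colP=> i; rewrite !mxE (inj_eq perm_inj).
Qed.

Lemma perm_mxV_col1 (k : nat) (s : 'S_k) (j : 'I_k) :
  perm_mx s^-1 *m col j 1%:M = col (s j) 1%:M :> 'cV[R]_k.
Proof. by rewrite -[in LHS](permK s j) perm_mx_col1. Qed.

Lemma tens_perm_mx_col1 (p q : nat) (s : 'S_q) (i : 'I_p) (j : 'I_q) :
  (1%:M *t perm_mx s) *m col (mxtens_index (i, s j)) 1%:M =
  col (mxtens_index (i, j)) 1%:M :> 'cV[R]_(p * q).
Proof.
have := tensmx_mul 1%:M (perm_mx s) (col i 1%:M) (col (s j) (1%:M : 'M[R]_q)).
by rewrite mul1mx perm_mx_col1 !tens_col1.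
Qed.

End LogicalVectors.

Section EquivalentStates.
Set Implicit Arguments.
Unset Strict Implicit.
Unset Printing Implicit Defensive.
Context {R : realType} {n m l : nat}.
Implicit Types (F : 'M[R]_(2 ^ n, 2 ^ m * 2 ^ n)) (H : 'M[R]_(2 ^ l, 2 ^ n)).

Lemma step_Delta F (w : 'cV[R]_(2 ^ m)) (x : 'cV[R]_(2 ^ n)) :
  F \in logical_mx (2 ^ n) (2 ^ m * 2 ^ n) ->
  w \in Delta (2 ^ m) -> x \in Delta (2 ^ n) ->
  (F *m (w *t x) : 'cV[R]_(2 ^ n)) \in Delta (2 ^ n).
Proof. by move=> hF hw hx; apply: logical_mulmx hF (tens_Delta hw hx). Qed.

Lemma state_Delta F (x : 'cV[R]_(2 ^ n)) (u : nat -> 'cV[R]_(2 ^ m)) t :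
  F \in logical_mx (2 ^ n) (2 ^ m * 2 ^ n) -> x \in Delta (2 ^ n) ->
  (forall s, (s < t)%N -> u s \in Delta (2 ^ m)) ->
  state F x u t \in Delta (2 ^ n).
Proof.
move=> hF hx; elim: t => [|t IHt] hu //=; apply: step_Delta => //.
  exact: hu.
by apply: IHt => s hs; apply: hu; apply: ltnW.
Qed.

Lemma state_cons F (x : 'cV[R]_(2 ^ n)) (w : 'cV[R]_(2 ^ m)) v t :
  state F x (fun s => if s is r.+1 then v r else w) t.+1 =
  state F (F *m (w *t x)) v t.
Proof. by elim: t => [|t IHt] //=; rewrite -IHt. Qed.

(** Inputs are infinite sequences, as in [O1_observable]; [x] is a state of [(F, H)] and [x'] one of
    [(F', H')]. *)
Definition equivalent F H F' H' (x x' : 'cV[R]_(2 ^ n)) : Prop :=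
  forall u : nat -> 'cV[R]_(2 ^ m), (forall t, u t \in Delta (2 ^ m)) ->
  forall t, output F' H' x' u t = output F H x u t.

Lemma equivalent_step F H F' H' x x' (w : 'cV[R]_(2 ^ m)) :
  w \in Delta (2 ^ m) -> equivalent F H F' H' x x' ->
  equivalent F H F' H' (F *m (w *t x)) (F' *m (w *t x')).
Proof.
move=> hw E u hu t; rewrite /output -!state_cons.
(* Time [t] after the step is time [t.+1] of the run whose input is [u] preceded by [w]. *)
by apply: (E _ _ t.+1) => -[|r].
Qed.

Lemma equivalent_state F H F' H' x x' (u : nat -> 'cV[R]_(2 ^ m)) t :
  (forall s, (s < t)%N -> u s \in Delta (2 ^ m)) ->
  equivalent F H F' H' x x' ->
  equivalent F H F' H' (state F x u t) (state F' x' u t).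
Proof.
move=> hu E; elim: t hu => [|t IHt] hu //=; apply: equivalent_step.
  exact: hu.
by apply: IHt => s hs; apply: hu; apply: ltnW.
Qed.

Lemma generates_data_equivalent F H F' H' x0 :
  generates_data F H x0 F' H' ->
  exists2 x0', x0' \in Delta (2 ^ n) & equivalent F H F' H' x0 x0'.
Proof.
(* The output at time [t] is read off the finite data with [p = t]. *)
by move=> [x0' hx0' E]; exists x0' => // u hu t; apply: (E t u) => // s _.
Qed.

Lemma equivalent_observable F H F' H' x y x' :
  O1_observable F H -> x \in Delta (2 ^ n) -> y \in Delta (2 ^ n) ->
  equivalent F H F' H' x x' -> equivalent F H F' H' y x' -> x = y.
Proof.
move=> obs hx hy Ex Ey; apply/eqP; apply/negPn/negP => /eqP xy.
have [u hu [t]] := obs x y hx hy xy.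
by rewrite -Ex // -Ey.
Qed.

Lemma equivalent_ex F H F' H' x0 x0' x :
  F' \in logical_mx (2 ^ n) (2 ^ m * 2 ^ n) -> controllable F ->
  x0 \in Delta (2 ^ n) -> x0' \in Delta (2 ^ n) ->
  equivalent F H F' H' x0 x0' -> x \in Delta (2 ^ n) ->
  exists2 x', x' \in Delta (2 ^ n) & equivalent F H F' H' x x'.
Proof.
move=> hF' ctrl hx0 hx0' E hx; have [T [u [hu <-]]] := ctrl x0 x hx0 hx.
(* The inputs steering [x0] to [x] are replayed on [(F', H')] from [x0']. *)
by exists (state F' x0' u T.+1); [exact: state_Delta|exact: equivalent_state].
Qed.

End EquivalentStates.

Theorem theorem3p11 (R : realType) (n m l : nat)
    (hn : (1 <= n)%N) (hm : (1 <= m)%N) (hl : (1 <= l)%N)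
    (F : 'M[R]_(2 ^ n, 2 ^ m * 2 ^ n)) (H : 'M[R]_(2 ^ l, 2 ^ n))
    (hF : F \in logical_mx (2 ^ n) (2 ^ m * 2 ^ n))
    (hH : H \in logical_mx (2 ^ l) (2 ^ n)) :
  controllable F -> O1_observable F H -> uniquely_identifiable F H.
Proof.
move=> ctrl obs x0 hx0 F' H' hF' _ /generates_data_equivalent[x0' hx0' E0].
pose e := fun k (i : 'I_k) => col i (1%:M : 'M[R]_k).
have /fin_all_exists[g Eg] i :
    exists j : 'I_(2 ^ n), equivalent F H F' H' (e _ i) (e _ j).
  have [_ /DeltaP[j ->] Ej] :=
    equivalent_ex hF' ctrl hx0 hx0' E0 (col1_Delta i).
  by exists j.
have g_inj : injective g.
  move=> i j eq_g; apply: (@col1_inj R).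
  apply: (equivalent_observable obs _ _ (Eg i)); rewrite ?col1_Delta //.
  by rewrite eq_g; apply: Eg.
pose s := perm g_inj.
have Es i : equivalent F H F' H' (e _ i) (e _ (s i)) by rewrite permE.
(* The inverse makes [G] send the basis vector of index [j] to that of index [s j]. *)
exists (perm_mx s^-1); rewrite tr_perm_mx invgK; split.
- exact: perm_mx_is_perm.
- apply: eq_mulmx_col1 => k; case: (mxtens_indexP k) => i j.
  rewrite -[j](permKV s); set j0 := (s^-1)%g j.
  rewrite -!mulmxA tens_perm_mx_col1.
  have := equivalent_step (col1_Delta i) (Es j0); rewrite !tens_col1.
  (* Under input [i], [a] is the successor of [j0] for [F], and [b] that of [s j0] for [F']. *)
  have /DeltaP[a ->] := logical_mulmx hF (col1_Delta (mxtens_index (i, j0))).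
  have /DeltaP[b ->] := logical_mulmx hF' (col1_Delta (mxtens_index (i, s j0))).
  rewrite -[b](permKV s) perm_mxV_col1 => Eab.
  congr (col (s _) 1%:M); apply: (@col1_inj R).
  by apply: (equivalent_observable obs _ _ (Es _) Eab); apply: col1_Delta.
- apply: eq_mulmx_col1 => j; rewrite -[j](permKV s) -mulmxA perm_mx_col1.
  (* The output at time 0 is [H] applied to the initial state; any admissible input, here a constant
     one, gives the equality. *)
  by apply: (Es _ (fun=> col (Ordinal (expn_gt0 2 m)) 1%:M) _ 0%N) => t;
    apply: col1_Delta.
Qed.
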